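(* Suppose that $B\in\mathbb{DC}^{m\times n}$. Then there exist a unitary matrix $\hat V\in\mathbb{DC}^{m\times m}$ and a unitary matrix $\hat U\in\mathbb{DC}^{n\times n}$ such that $$\hat V^*B\hat U=\begin{bmatrix}\Sigma_t&O\\O&O\end{bmatrix},$$ where $\Sigma_t\in\mathbb D^{t\times t}$ is a diagonal matrix, taking the form $$\Sigma_t=\mathrm{diag}\left(\mu_1,\cdots,\mu_r,\cdots,\mu_t\right),$$ $r\le t\le\min\{m,n\}$, $\mu_1\ge\mu_2\ge\cdots\ge\mu_r$ are positive appreciable dual numbers, and $\mu_{r+1}\ge\cdots\ge\mu_t$ are positive infinitesimal dual numbers. Counting possible multiplicities of the diagonal entries, the form $\Sigma_t$ is unique (i.e. uniquely determined by $B$).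
   Context: Let $\epsilon\neq 0$ be the infinitesimal unit, $\epsilon^2=0$, commuting with complex numbers. Dual complex numbers: $\mathbb{DC}=\{q=q_{st}+q_{\mathcal I}\epsilon : q_{st},q_{\mathcal I}\in\mathbb C\}$ (a commutative ring); dual numbers: $\mathbb D=\{q_{st}+q_{\mathcal I}\epsilon: q_{st},q_{\mathcal I}\in\mathbb R\}$. A number is appreciable if $q_{st}\neq0$ and infinitesimal otherwise. $\mathbb D$ is totally ordered: $p\le q$ iff $p_{st}<q_{st}$, or $p_{st}=q_{st}$ and $p_{\mathcal I}\le q_{\mathcal I}$; $q$ is positive if $q>0$. The conjugate of $q$ is $\bar q=\bar q_{st}+\bar q_{\mathcal I}\epsilon$; for a matrix $A=(a_{ij})$ over $\mathbb{DC}$, $A^*=(\bar a_{ji})$. A square matrix $A\in\mathbb{DC}^{n\times n}$ is unitary if $A^*A=I_n$. The integers $r,t$ are nonnegative. *)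

(* Defs.v *)
From HB Require Import structures.
From mathcomp Require Import all_boot all_order all_algebra.
From mathcomp Require Import complex reals.

Set Implicit Arguments.
Unset Strict Implicit.
Unset Printing Implicit Defensive.

Import Order.TTheory GRing.Theory Num.Theory.

Local Open Scope ring_scope.

(* Dual a b stands for a + b * eps with eps ^ 2 = 0. For R the reals, dual R    *)
(* is the ring of dual numbers and dual R[i] that of dual complex numbers.     *)
Record dual (K : Type) := Dual { dst : K; dinf : K }.

Section DualChoice.
Variable K : choiceType.

Definition pair_of_dual (q : dual K) : K * K := (dst q, dinf q).
Definition dual_of_pair (p : K * K) : dual K := Dual p.1 p.2.

Lemma pair_of_dualK : cancel pair_of_dual dual_of_pair.
Proof. by case. Qed.

HB.instance Definition _ := Choice.copy (dual K) (can_type pair_of_dualK).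
End DualChoice.

Section DualZmodule.
Variable K : zmodType.
Implicit Types p q : dual K.

Definition dual_zero : dual K := Dual 0 0.
Definition dual_opp q := Dual (- dst q) (- dinf q).
Definition dual_add p q := Dual (dst p + dst q) (dinf p + dinf q).

Lemma dual_addA : associative dual_add.
Proof. by move=> p q s; rewrite /dual_add /= !addrA. Qed.

Lemma dual_addC : commutative dual_add.
Proof.
by move=> p q; rewrite /dual_add addrC [dinf p + _]addrC.
Qed.

Lemma dual_add0 : left_id dual_zero dual_add.
Proof. by case=> a b; rewrite /dual_add /= !add0r. Qed.

Lemma dual_addN : left_inverse dual_zero dual_opp dual_add.
Proof. by move=> q; rewrite /dual_add /= !addNr. Qed.

HB.instance Definition _ := GRing.isZmodule.Build (dual K)
  dual_addA dual_addC dual_add0 dual_addN.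
End DualZmodule.

Section DualRing.
Variable K : comNzRingType.
Implicit Types p q : dual K.

Definition dual_one : dual K := Dual 1 0.
Definition dual_mul p q :=
  Dual (dst p * dst q) (dst p * dinf q + dinf p * dst q).

Lemma dual_mulA : associative dual_mul.
Proof.
by move=> p q s; rewrite /dual_mul /= mulrDl mulrDr !mulrA addrA.
Qed.

Lemma dual_mulC : commutative dual_mul.
Proof.
move=> p q; rewrite /dual_mul [dst p * dst q]mulrC addrC.
by rewrite [dinf p * _]mulrC [dst p * _]mulrC.
Qed.

Lemma dual_mul1 : left_id dual_one dual_mul.
Proof. by case=> a b; rewrite /dual_mul /= !mul1r mul0r addr0. Qed.

Lemma dual_mulDl : left_distributive dual_mul +%R.
Proof.
move=> p q s; rewrite /dual_mul [in RHS]/GRing.add /= /dual_add /= !mulrDl.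
by rewrite addrACA.
Qed.

Lemma dual_one_neq0 : dual_one != 0.
Proof. by apply/eqP => -[] /eqP; rewrite oner_eq0. Qed.

HB.instance Definition _ := GRing.Zmodule_isComNzRing.Build (dual K)
  dual_mulA dual_mulC dual_mul1 dual_mulDl dual_one_neq0.
End DualRing.

Section DualOrder.
Variable R : realDomainType.
Implicit Types p q : dual R.

Definition dual_le p q :=
  (dst p < dst q) || (dst p == dst q) && (dinf p <= dinf q).

Lemma dual_le_refl : reflexive dual_le.
Proof. by move=> p; rewrite /dual_le eqxx lexx orbT. Qed.

Lemma dual_le_anti : antisymmetric dual_le.
Proof.
case=> [a b] [c d]; rewrite /dual_le /= => /andP[].
by case: ltgtP => //= -> bd db; congr Dual; apply/le_anti/andP.
Qed.

Lemma dual_le_trans : transitive dual_le.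
Proof.
move=> [c d] [a b] [e f]; rewrite /dual_le /=.
case/orP=> [ac|/andP[/eqP-> bd]]; case/orP=> [ce|/andP[/eqP<- df]].
- by rewrite (lt_trans ac ce).
- by rewrite ac.
- by rewrite ce.
- by rewrite eqxx (le_trans bd df) orbT.
Qed.

HB.instance Definition _ := Order.Le_isPOrder.Build ring_display (dual R)
  dual_le_refl dual_le_anti dual_le_trans.

Lemma dual_le_total : total (<=%O : rel (dual R)).
Proof.
move=> p q; rewrite /Order.le /= /dual_le.
by case: ltgtP => //= _; exact: le_total.
Qed.

HB.instance Definition _ :=
  Order.POrder_isTotal.Build ring_display (dual R) dual_le_total.
End DualOrder.

Definition appreciable (K : nmodType) (q : dual K) : bool := dst q != 0.
Definition infinitesimal (K : nmodType) (q : dual K) : bool :=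
  ~~ appreciable q.

Section DualComplex.
Variable R : rcfType.

Definition dual_complex (q : dual R) : dual R[i] :=
  Dual (real_complex R (dst q)) (real_complex R (dinf q)).

Definition dual_conj (q : dual R[i]) : dual R[i] :=
  Dual (conjc (dst q)) (conjc (dinf q)).

Definition conjtr_mx (m n : nat) (A : 'M[dual R[i]]_(m, n)) :
  'M[dual R[i]]_(n, m) := (map_mx dual_conj A)^T.

Definition unitary_mx (n : nat) (A : 'M[dual R[i]]_n) : Prop :=
  conjtr_mx A *m A = 1%:M.

(* The m x n matrix [Sigma 0; 0 0]. It is only meaningful for t <= m and       *)
(* t <= n, when conform_mx merely casts along t + (m - t) = m and              *)
(* t + (n - t) = n; otherwise its value is the junk 0.                         *)
Definition pad_mx (m n t : nat) (Sigma : 'M[dual R[i]]_t) :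
  'M[dual R[i]]_(m, n) :=
  conform_mx 0 (block_mx Sigma 0 0 0 : 'M_(t + (m - t), t + (n - t))).

Definition Sigma_mx (t : nat) (mu : t.-tuple (dual R)) : 'M[dual R]_t :=
  diag_mx (\row_i tnth mu i).

(* Indices are 0-based: mu_1, ..., mu_r are the tnth mu i with i < r.          *)
Definition dual_svd (m n : nat) (B : 'M[dual R[i]]_(m, n))
    (V : 'M[dual R[i]]_m) (U : 'M[dual R[i]]_n)
    (r t : nat) (mu : t.-tuple (dual R)) : Prop :=
  [/\ unitary_mx V,
      unitary_mx U,
      conjtr_mx V *m B *m U = pad_mx m n (map_mx dual_complex (Sigma_mx mu)) &
  [/\ (r <= t <= minn m n)%N,
      forall i : 'I_t, (i < r)%N -> 0 < tnth mu i /\ appreciable (tnth mu i),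
      forall i j : 'I_t, (i <= j < r)%N -> tnth mu j <= tnth mu i,
      forall i : 'I_t, (r <= i)%N -> 0 < tnth mu i /\ infinitesimal (tnth mu i) &
      forall i j : 'I_t, (r <= i <= j)%N -> tnth mu j <= tnth mu i ]].

End DualComplex.

(* Main.v *)
Require Import Defs.
From HB Require Import structures.
From mathcomp Require Import all_boot all_order all_algebra.
From mathcomp Require Import fingroup perm sesquilinear spectral.
From mathcomp Require Import complex reals.

(** Existence. If the standard part of [B] is nonzero, then [B *m B^*] is a
    dual Hermitian matrix whose standard part has an eigenvalue [a > 0], and
    first-order perturbation theory lifts it to a unit row [v] over the dual
    complex numbers with [v *m B *m B^* = (a + b eps) *: v], [a] and [b] real.
    This appreciable eigenvalue has a dual square root [mu > 0], and
    [u = mu^-1 *: v *m B] is again a unit row. Completing [v] and [u] to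
    unitary matrices [P] and [Q] makes [P *m B *m Q^*] block diagonal with
    leading entry [mu] ([split_singular_value_appreciable]). If [B = B1 eps]
    with [B1] nonzero, the same splitting for [B1], multiplied by [eps],
    produces a positive infinitesimal [mu]. Induction on the size gives a
    rectangular diagonal form with positive diagonal ([rdiag_mx_exists]), and
    a permutation sorts the diagonal. As appreciable positive dual numbers
    exceed infinitesimal ones, sorting also puts the appreciable ones first.

    Uniqueness. Two decompositions with diagonals [s] and [s'] are linked by
    unitary matrices [W], [Z] with [W S = S' Z] and, taking adjoints,
    [Z S^T = S'^T W]. Entrywise, [W i j * s_j = s'_i * Z i j] and
    [Z i j * s_j = s'_i * W i j], so [W i j + Z i j] is killed by [s_j - s'_i]
    and [W i j - Z i j] by [s_j + s'_i]. When [s_j] is positive and differs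
    from [s'_i], the standard part of [W i j] therefore vanishes
    ([dst_intertwine_eq0]). For each [c > 0], the columns [j] with [s_j = c]
    of the complex unitary matrix [st W] are thus supported on the rows [i]
    with [s'_i = c], and there are at least as many such rows as columns
    ([unitary_support_card]). By symmetry [s] and [s'] have the same
    multiplicities, and both are sorted. The matrix [B *m B^*] alone would not
    do for this: it does not see the infinitesimal singular values. *)

Set Implicit Arguments.
Unset Strict Implicit.
Unset Printing Implicit Defensive.

Import Order.TTheory GRing.Theory Num.Theory.

Local Open Scope ring_scope.
Local Open Scope sesquilinear_scope.

(** * Complex matrices and first-order perturbation of eigenvalues *)

Section ComplexMatrices.
Variable C : numClosedFieldType.

Local Notation "B ^!" :=
  (orthomx Num.conj (mx_of_hermitian (hermitian1mx _)) B) : matrix_set_scope.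

Lemma adjM m n p (A : 'M[C]_(m, n)) (B : 'M[C]_(n, p)) :
  (A *m B)^t* = B^t* *m A^t*.
Proof. by rewrite trmx_mul map_mxM. Qed.

Lemma adjD m n (A B : 'M[C]_(m, n)) : (A + B)^t* = A^t* + B^t*.
Proof. by rewrite raddfD /= map_mxD. Qed.

Lemma adjB m n (A B : 'M[C]_(m, n)) : (A - B)^t* = A^t* - B^t*.
Proof. by rewrite raddfB /= map_mxB. Qed.

Lemma adjZ m n a (A : 'M[C]_(m, n)) : (a *: A)^t* = a^* *: A^t*.
Proof. by rewrite linearZ /= map_mxZ. Qed.

Lemma adj_scalar n (a : C) : (a%:M : 'M_n)^t* = a^*%:M.
Proof. by rewrite tr_scalar_mx map_scalar_mx. Qed.

Lemma mulmx_adj_eq0 m n (A : 'M[C]_(m, n)) : A *m A^t* = 0 -> A = 0.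
Proof.
move=> /orthomx1P/orthomx_disj AA; apply/eqP.
by rewrite -submx0 -AA sub_capmx submx_refl.
Qed.

Lemma unit_row_of_neq0 n (v : 'rV[C]_n) : v != 0 ->
  exists2 c : C, c != 0 & (c *: v) *m (c *: v)^t* = 1%:M.
Proof.
move=> v0; have dv : 0 < dotmx v v by exact: dotmx_is_dotmx.
exists (sqrtC (dotmx v v))^-1; first by rewrite invr_eq0 sqrtC_eq0 gt_eqF.
rewrite adjZ -scalemxAl -scalemxAr scalerA.
have c_real : ((sqrtC (dotmx v v))^-1)^* = (sqrtC (dotmx v v))^-1.
  by apply: geC0_conj; rewrite invr_ge0 sqrtC_ge0 ltW.
rewrite c_real -invfM -expr2 sqrtCK [v *m _]mx11_scalar -dotmxE.
by rewrite -mul_scalar_mx -scalar_mxM mulVf // gt_eqF.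
Qed.

(** The Gram-Schmidt process leaves a unit first row unchanged. *)
Lemma unitary_completion n (v : 'rV[C]_(1 + n)) : v *m v^t* = 1%:M ->
  exists2 P : 'M[C]_(1 + n), P \is unitarymx & row 0 P = v.
Proof.
move=> v1; pose A : 'M[C]_(1 + n) := col_mx v 0.
have rA : row 0 A = v.
  apply/rowP => j; rewrite mxE -[RHS](col_mxEu v (0 : 'M_(n, _)) 0 j).
  by congr (A _ j); apply/val_inj.
exists (schmidt A); first exact: schmidt_unitarymx.
set s := row 0 (schmidt A).
have s1 : dotmx s s = 1.
  have /row_unitarymxP/(_ 0 0) := schmidt_unitarymx A (leqnn _).
  by rewrite eqxx.
have /sub_rVP[c vE] : (v <= s)%MS.
  have := row_schmidt_sub A 0; rewrite rA (big_pred1 0) ?genmxE // => k /=.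
  by rewrite leqn0.
have vv : dotmx v v = 1 by rewrite dotmxE v1 mxE eqxx.
have c0 : 0 <= c.
  by have := form1_row_schmidt A 0; rewrite rA -/s vE linearZl_LR /= s1 mulr1.
move: vv; rewrite vE linearZl_LR linearZr_LR /= s1 mulr1 geC0_conj // -expr2.
move/eqP; rewrite sqrf_eq1 => /orP[/eqP->|/eqP c1]; first by rewrite scale1r.
by move: c0; rewrite c1 oppr_ge0 ler10.
Qed.

Lemma hermitian_eigenvalue_real n (H : 'M[C]_n) (v : 'rV[C]_n) a :
  H^t* = H -> v *m v^t* = 1%:M -> v *m H = a *: v -> a^* = a.
Proof.
move=> HH v1 vH; have aE : v *m H *m v^t* = a%:M.
  by rewrite vH -scalemxAl v1 scalemx1.
have /matrixP/(_ 0 0) := congr1 (fun M : 'M_1 => M^t*) aE.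
by rewrite !adjM HH trmxCK mulmxA aE adj_scalar !mxE eqxx !mulr1n => <-.
Qed.

(** An eigenvalue [a] of a Hermitian matrix [H] lifts to an eigenvalue
    [a + b eps] of [H + K eps], with eigenvector [v0 + v1 eps]. Here [v0] is
    an eigenvector, for [b], of the compression of [K] to the eigenspace of
    [a], so that [b *: v0 - v0 *m K] is orthogonal to that eigenspace, hence
    in the range of [H - a]. *)
Lemma first_order_eigenvector n (H K : 'M[C]_n) a :
  H^t* = H -> K^t* = K -> eigenvalue H a ->
  exists v0 v1 : 'rV[C]_n, exists b : C,
    [/\ v0 *m v0^t* = 1%:M, v1 *m v0^t* = 0, v0 *m H = a *: v0,
        v0 *m K + v1 *m H = a *: v1 + b *: v0 & a^* = a /\ b^* = b].
Proof.
move=> HH KK Ha; pose E := eigenspace H a; pose P := proj_ortho E.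
have stabE : stablemx E (K *m P) by rewrite mulmxA proj_ortho_sub.
have E_gt0 : (0 < \rank E)%N by rewrite lt0n mxrank_eq0.
have [b0] := eigenvalue_closed (restrictmx E (K *m P)) E_gt0.
move=> /eigenvalueP[w wb w0].
pose v := w *m row_base E.
have vE : (v <= E)%MS by rewrite mulmx_sub // eq_row_base.
have v0 : v != 0 by rewrite mulmx_free_eq0 ?row_base_free.
have [b /eigenspaceP vb] : exists b, (v <= eigenspace (K *m P) b)%MS.
  apply/eigenvectorP; rewrite -stablemx_restrict //.
  by apply/eigenvectorP; exists b0; apply/eigenspaceP.
have [c c0 cv1] := unit_row_of_neq0 v0.
set u := c *: v in cv1.
have uE : (u <= E)%MS by rewrite scalemx_sub.
have uH : u *m H = a *: u by apply/eigenspaceP.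
have ub : u *m (K *m P) = b *: u by rewrite -scalemxAl vb !scalerA mulrC.
clearbody u; clear v vE v0 vb c c0.
have ar : a^* = a by apply: hermitian_eigenvalue_real cv1 uH.
(* The right-hand side of the equation y (H - a) = z for y. *)
pose z := b *: u - u *m K.
have zP : z *m P = 0.
  by rewrite mulmxBl -scalemxAl proj_ortho_id // -mulmxA ub subrr.
have zE : (z <= E^!)%MS by rewrite -[z]subr0 -zP proj_ortho_compl_sub.
(* H - a is Hermitian, so its range is the orthogonal complement of its kernel
   E. *)
have /submxP[y yE] : (z <= H - a%:M)%MS.
  rewrite -(ortho_id (H - a%:M)); apply: submx_trans zE _.
  rewrite submx_ortho; apply/eigenspaceP.
  have /orthomx1P := submx_refl (H - a%:M)^!%MS.
  rewrite adjB HH adj_scalar ar mulmxBr mul_mx_scalar => /eqP.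
  by rewrite subr_eq0 => /eqP.
(* Removing the component of y along u keeps it a solution. *)
pose v1 := y - (y *m u^t*) 0 0 *: u.
have v1u : v1 *m u^t* = 0.
  by rewrite mulmxBl -scalemxAl cv1 scalemx1 -mx11_scalar subrr.
have v1E : u *m K + v1 *m H = a *: v1 + b *: u.
  have : y *m H - a *: y = b *: u - u *m K.
    by rewrite -/z yE mulmxBr mul_mx_scalar.
  rewrite /v1 mulmxBl -scalemxAl uH scalerBr !scalerA [_ * a]mulrC.
  move/(canRL (subrK _)) => ->; rewrite [RHS]addrC !addrA; congr (_ - _).
  by rewrite [u *m K + _]addrC addrK.
clearbody v1; exists u, v1, b; split=> //; split=> //.
have bE : u *m K *m u^t* = b%:M.
  move: (congr1 (fun M => M *m u^t*) v1E).
  rewrite !mulmxDl -!scalemxAl v1u cv1 scaler0 add0r -[v1 *m H *m _]mulmxA.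
  have -> : H *m u^t* = a *: u^t* by rewrite -{1}HH -adjM uH adjZ ar.
  by rewrite -scalemxAr v1u scaler0 addr0 scalemx1.
have /matrixP/(_ 0 0) := congr1 (fun M : 'M_1 => M^t*) bE.
by rewrite !adjM KK trmxCK mulmxA bE adj_scalar !mxE eqxx !mulr1n => <-.
Qed.

(** If [A] is nonzero, the positive semidefinite matrix [A *m A^t*] is nonzero
    and diagonalizable, so it has a positive eigenvalue. *)
Lemma gram_eigenvalue_gt0 m n (A : 'M[C]_(m, n)) : A != 0 ->
  exists2 a, eigenvalue (A *m A^t*) a & 0 < a.
Proof.
move=> A0; set H := A *m A^t*.
have HH : H^t* = H by rewrite adjM trmxCK.
have /orthomx_spectralP HE : H \is normalmx by apply/normalmxP; rewrite HH.
set P := spectralmx H in HE; set d := spectral_diag H in HE.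
have [i di] : exists i, d 0 i != 0.
  apply/existsP; apply: contraNT A0; rewrite negb_exists => /forallP d0.
  have {}d0 : d = 0 by apply/rowP => i; rewrite mxE; apply/eqP/negPn/d0.
  apply/eqP/mulmx_adj_eq0; rewrite -/H HE d0.
  by rewrite (_ : diag_mx 0 = 0) ?mulmx0 ?mul0mx // raddf0.
have Hi : row i P *m H = d 0 i *: row i P.
  rewrite HE !mulmxA rowE -(mulmxA (delta_mx 0 i)) mulmxV ?spectral_unit //.
  by rewrite mulmx1 -rowE row_diag_mx -scalemxAl.
have Pi : row i P != 0.
  have /row_unitarymxP/(_ i i) := spectral_unitarymx H.
  rewrite eqxx -/P; apply: contra_eq_neq => ->.
  by rewrite linear0l eq_sym oner_eq0.
exists (d 0 i); first by apply/eigenvalueP; exists (row i P).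
have [c c0 v1] := unit_row_of_neq0 Pi; set v := c *: _ in v1.
have vH : v *m H = d 0 i *: v by rewrite -scalemxAl Hi !scalerA mulrC.
have : dotmx (v *m A) (v *m A) = d 0 i.
  rewrite dotmxE adjM mulmxA -(mulmxA v) -/H vH -scalemxAl v1.
  by rewrite !mxE eqxx mulr1.
move=> dE; have vA0 : v *m A != 0.
  apply: contra_neq di => vA; rewrite -dE vA dotmxE mul0mx mxE //.
by rewrite -dE dotmx_is_dotmx.
Qed.

End ComplexMatrices.

(** * Matrices over the dual complex numbers *)

Section DualMatrices.
Variable K : comNzRingType.

(** The matrix [A0 + A1 eps]. *)
Definition dual_mx m n (A0 A1 : 'M[K]_(m, n)) : 'M[dual K]_(m, n) :=
  \matrix_(i, j) Dual (A0 i j) (A1 i j).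

Lemma dst_sum I (s : seq I) (F : I -> dual K) :
  dst (\sum_(i <- s) F i) = \sum_(i <- s) dst (F i).
Proof. by elim/big_ind2: _ => // _ x _ y <- <-. Qed.

Lemma dinf_sum I (s : seq I) (F : I -> dual K) :
  dinf (\sum_(i <- s) F i) = \sum_(i <- s) dinf (F i).
Proof. by elim/big_ind2: _ => // _ x _ y <- <-. Qed.

Lemma dualP (p q : dual K) : dst p = dst q -> dinf p = dinf q -> p = q.
Proof. by case: p q => a b [c d] /= -> ->. Qed.

Lemma dual_mxE m n (A : 'M[dual K]_(m, n)) :
  A = dual_mx (map_mx (@dst K) A) (map_mx (@dinf K) A).
Proof. by apply/matrixP => i j; rewrite !mxE; case: (A i j). Qed.

Lemma dual_mxM m n p (A0 A1 : 'M[K]_(m, n)) (B0 B1 : 'M[K]_(n, p)) :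
  dual_mx A0 A1 *m dual_mx B0 B1 = dual_mx (A0 *m B0) (A0 *m B1 + A1 *m B0).
Proof.
apply/matrixP => i j; apply: dualP; rewrite !mxE ?(dst_sum, dinf_sum) /=.
  by apply: eq_bigr => k _; rewrite !mxE.
by rewrite -big_split; apply: eq_bigr => k _; rewrite !mxE.
Qed.

Lemma dual_mxZ m n (A0 A1 : 'M[K]_(m, n)) (c : dual K) :
  c *: dual_mx A0 A1 = dual_mx (dst c *: A0) (dst c *: A1 + dinf c *: A0).
Proof. by apply/matrixP => i j; rewrite !mxE. Qed.

Lemma dual_mx1 n : (1%:M : 'M[dual K]_n) = dual_mx 1%:M 0.
Proof. by apply/matrixP => i j; rewrite !mxE; case: eqP. Qed.

Lemma dual_mx_inj m n (A0 A1 B0 B1 : 'M[K]_(m, n)) :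
  dual_mx A0 A1 = dual_mx B0 B1 -> A0 = B0 /\ A1 = B1.
Proof.
by move/matrixP=> AB; split; apply/matrixP => i j; have := AB i j;
  rewrite !mxE => -[].
Qed.

End DualMatrices.

Section DualComplexMatrices.
Variable R : rcfType.
Local Notation C := R[i].
Local Notation DC := (dual R[i]).

Fact dual_conj_zmod_morphism : zmod_morphism (@dual_conj R).
Proof. by move=> p q; apply: dualP; rewrite /= rmorphB. Qed.

Fact dual_conj_monoid_morphism : monoid_morphism (@dual_conj R).
Proof.
split=> [|p q]; apply: dualP; [exact: conjc1 | exact: conjc0 | |] => /=.
  by rewrite rmorphM.
by rewrite rmorphD !rmorphM.
Qed.

HB.instance Definition _ :=
  GRing.isZmodMorphism.Build _ _ (@dual_conj R) dual_conj_zmod_morphism.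
HB.instance Definition _ :=
  GRing.isMonoidMorphism.Build _ _ (@dual_conj R) dual_conj_monoid_morphism.

Fact dual_complex_zmod_morphism : zmod_morphism (@dual_complex R).
Proof. by move=> p q; apply: dualP; rewrite /= rmorphB. Qed.

Fact dual_complex_monoid_morphism : monoid_morphism (@dual_complex R).
Proof.
split=> [|p q]; apply: dualP => /=; rewrite ?rmorph1 ?rmorph0 ?rmorphM //.
by rewrite rmorphD !rmorphM.
Qed.

HB.instance Definition _ :=
  GRing.isZmodMorphism.Build _ _ (@dual_complex R) dual_complex_zmod_morphism.
HB.instance Definition _ :=
  GRing.isMonoidMorphism.Build _ _ (@dual_complex R)
    dual_complex_monoid_morphism.

Lemma dual_conjK : involutive (@dual_conj R).
Proof. by case=> a b; rewrite /dual_conj /= !conjcK. Qed.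

Lemma dual_conj_complex (p : dual R) :
  dual_conj (dual_complex p) = dual_complex p.
Proof. by apply: dualP; apply: conjc_real. Qed.

Lemma conjtr_mxM m n p (A : 'M[DC]_(m, n)) (B : 'M[DC]_(n, p)) :
  conjtr_mx (A *m B) = conjtr_mx B *m conjtr_mx A.
Proof. by rewrite /conjtr_mx map_mxM trmx_mul. Qed.

Lemma conjtr_mxK m n (A : 'M[DC]_(m, n)) : conjtr_mx (conjtr_mx A) = A.
Proof. by apply/matrixP => i j; rewrite !mxE dual_conjK. Qed.

Lemma conjtr_mxZ m n c (A : 'M[DC]_(m, n)) :
  conjtr_mx (c *: A) = dual_conj c *: conjtr_mx A.
Proof. by rewrite /conjtr_mx map_mxZ linearZ. Qed.

Lemma conjtr_mx1 n : conjtr_mx (1%:M : 'M[DC]_n) = 1%:M.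
Proof. by rewrite /conjtr_mx map_mx1 trmx1. Qed.

Lemma conjtr_block_mx m1 m2 n1 n2 (A : 'M[DC]_(m1, n1)) (B : 'M[DC]_(m1, n2))
    (A' : 'M[DC]_(m2, n1)) (B' : 'M[DC]_(m2, n2)) :
  conjtr_mx (block_mx A B A' B') =
  block_mx (conjtr_mx A) (conjtr_mx A') (conjtr_mx B) (conjtr_mx B').
Proof. by rewrite /conjtr_mx map_block_mx tr_block_mx. Qed.

Lemma conjtr_dual_mx m n (A0 A1 : 'M[C]_(m, n)) :
  conjtr_mx (dual_mx A0 A1) = dual_mx (A0^t*) (A1^t*).
Proof. by apply/matrixP => i j; rewrite !mxE. Qed.

Lemma unitary_mxV n (P : 'M[DC]_n) :
  unitary_mx P -> P *m conjtr_mx P = 1%:M.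
Proof. exact: mulmx1C. Qed.

Lemma unitary_mx_conjtr n (P : 'M[DC]_n) :
  unitary_mx P -> unitary_mx (conjtr_mx P).
Proof. by move=> /unitary_mxV; rewrite /unitary_mx conjtr_mxK. Qed.

Lemma unitary_mx_mul n (P Q : 'M[DC]_n) :
  unitary_mx P -> unitary_mx Q -> unitary_mx (P *m Q).
Proof.
rewrite /unitary_mx => PP QQ.
by rewrite conjtr_mxM mulmxA -(mulmxA _ _ P) PP mulmx1.
Qed.

Lemma unitary_mx1 n : unitary_mx (1%:M : 'M[DC]_n).
Proof. by rewrite /unitary_mx conjtr_mx1 mulmx1. Qed.

Lemma unitary_block_diag m n (P : 'M[DC]_m) (Q : 'M[DC]_n) :
  unitary_mx P -> unitary_mx Q -> unitary_mx (block_mx P 0 0 Q).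
Proof.
rewrite /unitary_mx => PP QQ; rewrite conjtr_block_mx mulmx_block.
have z i j : conjtr_mx (0 : 'M[DC]_(i, j)) = 0.
  by rewrite /conjtr_mx map_mx0 trmx0.
by rewrite !z PP QQ !mulmx0 !mul0mx !addr0 !add0r -scalar_mx_block.
Qed.

Lemma unitary_perm_mx n (s : 'S_n) : unitary_mx (perm_mx s : 'M[DC]_n).
Proof.
rewrite /unitary_mx /conjtr_mx map_perm_mx tr_perm_mx -perm_mxM.
by rewrite mulVg perm_mx1.
Qed.

(** A unit row [v0 + v1 eps] is the first row of [P (1 + X eps)], where the
    complex unitary matrix [P] has first row [v0] and [X] is skew-Hermitian
    with [v0 *m X = v1]. *)
Lemma dual_unitary_completion n (v : 'rV[DC]_(1 + n)) :
  v *m conjtr_mx v = 1%:M ->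
  exists2 P : 'M[DC]_(1 + n), unitary_mx P & row 0 P = v.
Proof.
rewrite (dual_mxE v); set v0 := map_mx _ v; set v1 := map_mx _ v.
clearbody v0 v1; clear v.
rewrite conjtr_dual_mx dual_mxM dual_mx1 => /dual_mx_inj[v00 v01].
have [P0 /unitarymxP P0u P0r] := unitary_completion v00.
pose x : C := (v0 *m v1^t*) 0 0.
have xE : v0 *m v1^t* = x%:M by rewrite [LHS]mx11_scalar.
have xbE : v1 *m v0^t* = (x^*)%C%:M.
  by rewrite -[v1]trmxCK -adjM xE adj_scalar.
have xN : (x^*)%C = - x.
  move: v01; rewrite xE xbE => /matrixP/(_ 0 0).
  by rewrite !mxE eqxx !mulr1n => /eqP; rewrite addrC addr_eq0 => /eqP.
(* The first two terms map v0 to v1 - x v0; the last one, skew-Hermitian since x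
   is purely imaginary, restores x v0. *)
pose X := v0^t* *m v1 - v1^t* *m v0 + x *: (v0^t* *m v0).
have Xskew : X^t* = - X.
  rewrite adjD adjB adjZ !adjM !trmxCK [_^*]xN scaleNr /X !opprD opprK.
  by rewrite [- _ + _]addrC.
have v0X : v0 *m X = v1.
  rewrite mulmxDr mulmxBr -scalemxAr !mulmxA v00 xE !mul1mx mul_scalar_mx.
  by rewrite subrK.
exists (dual_mx P0 (P0 *m X)); last first.
  apply/rowP => j; rewrite !mxE; congr Dual.
    by rewrite -P0r mxE.
  by have /rowP/(_ j) := v0X; rewrite -P0r -row_mul !mxE.
have P0u' := mulmx1C P0u.
rewrite /unitary_mx conjtr_dual_mx dual_mxM P0u' dual_mx1 adjM Xskew.
by congr dual_mx; rewrite mulmxA P0u' mul1mx -mulmxA P0u' mulmx1 subrr.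
Qed.

End DualComplexMatrices.

(** * The order on dual numbers *)

Section DualOrderFacts.
Variable R : realDomainType.
Implicit Types p q : dual R.

Lemma dual_leE p q :
  (p <= q) = (dst p < dst q) || (dst p == dst q) && (dinf p <= dinf q).
Proof. by []. Qed.

Lemma dual_gt0E p : (0 < p) = (0 < dst p) || (dst p == 0) && (0 < dinf p).
Proof.
rewrite lt_neqAle dual_leE /= [0 == dst p]eq_sym.
case: p => a b /=; have -> : (0 != Dual a b) = ~~ ((a == 0) && (b == 0)).
  by congr negb; apply/eqP/andP => [[<- <-]|[/eqP-> /eqP->]].
by case: ltgtP => //= _; rewrite [RHS]lt_neqAle eq_sym.
Qed.

Lemma dual_gt0_dst_ge0 p : 0 < p -> 0 <= dst p.
Proof. by rewrite dual_gt0E => /orP[/ltW|/andP[/eqP->]]. Qed.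

Lemma dual_gt0_appreciable p : 0 < p -> appreciable p = (0 < dst p).
Proof. by move/dual_gt0_dst_ge0 => p0; rewrite lt_neqAle p0 andbT eq_sym. Qed.

End DualOrderFacts.

(** If the entries of [s] satisfying [a] form a prefix, its length is their
    number. *)
Lemma nth_count_prefix (T : Type) (a : pred T) x0 (s : seq T) :
  (forall i j, (i <= j < size s)%N -> a (nth x0 s j) -> a (nth x0 s i)) ->
  forall i, (i < size s)%N -> a (nth x0 s i) = (i < count a s)%N.
Proof.
elim: s => //= x s IHs as_ i is_; have [ax|nax] := boolP (a x).
  case: i is_ => [|i] is_ /=; first by rewrite ax.
  by rewrite add1n ltnS IHs // => k l kl; apply: (as_ k.+1 l.+1).
have na k : (k < (size s).+1)%N -> a (nth x0 (x :: s) k) = false.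
  by move=> ks; apply: contraNF nax; apply: (as_ 0%N k).
rewrite na // add0n (_ : count a s = 0%N) //; apply/eqP.
rewrite -leqn0 leqNgt -has_count; apply/(has_nthP x0) => -[k ks].
by rewrite (na k.+1).
Qed.

(** * Existence of the decomposition *)

Section Existence.
Variable R : rcfType.
Local Notation C := R[i].
Local Notation DC := (dual R[i]).

Lemma conjc_fixed_real (a : C) : (a^*)%C = a -> a = (complex.Re a)%:C%C.
Proof.
case: a => x y [] /eqP; rewrite eq_sym -addr_eq0 -mulr2n mulrn_eq0 /=.
by move/eqP->.
Qed.

(** A dual left singular vector [v] for an appreciable singular value [mu],
    obtained by lifting a positive eigenvalue of the standard part of [B B^*]. *)
Lemma singular_row m n (B : 'M[DC]_(m, n)) : map_mx (@dst C) B != 0 ->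
  exists (v : 'rV[DC]_m) (mu : dual R),
    [/\ v *m conjtr_mx v = 1%:M, 0 < dst mu &
        v *m (B *m conjtr_mx B) = dual_complex (mu * mu) *: v].
Proof.
rewrite (dual_mxE B); set B0 := map_mx _ B; set B1 := map_mx _ B.
clearbody B0 B1; clear B; move=> B0n.
have {}B0n : B0 != 0.
  by apply: contra_neq B0n => ->; apply/matrixP => i j; rewrite !mxE.
have [a Ha a0] := gram_eigenvalue_gt0 B0n.
pose H := B0 *m B0^t*; pose K := B0 *m B1^t* + B1 *m B0^t*.
have HH : H^t* = H by rewrite adjM trmxCK.
have KK : K^t* = K by rewrite adjD !adjM !trmxCK addrC.
have [v0 [v1 [b [v00 v10 v0H v1H [ac bc]]]]] :=
  first_order_eigenvector HH KK Ha.
have aR := conjc_fixed_real ac; have bR := conjc_fixed_real bc.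
set a' := complex.Re a in aR; set b' := complex.Re b in bR.
have a'0 : 0 < a' by move: a0; rewrite aR ltcR.
(* The dual square root of a' + b' eps. *)
pose s := Num.sqrt a'; pose mu : dual R := Dual s (b' / (2 * s)).
have s0 : 0 < s by rewrite sqrtr_gt0.
have mu2 : mu * mu = Dual a' b'.
  apply: dualP => /=; first by rewrite -expr2 sqr_sqrtr // ltW.
  rewrite [s * _]mulrC -mulrDr -mulr2n -[s *+ 2]mulr_natl divfK //.
  by rewrite gt_eqF // mulr_gt0.
exists (dual_mx v0 v1), mu; split=> //.
  rewrite conjtr_dual_mx dual_mxM dual_mx1 v00 v10 addr0.
  by congr dual_mx; rewrite -[v0]trmxCK -adjM v10 trmx0 map_mx0.
rewrite conjtr_dual_mx dual_mxM mu2 dual_mxM dual_mxZ -/H -/K v0H v1H /=.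
by rewrite -aR -bR.
Qed.

Lemma block_mx_of_cross m n (a : DC) (M : 'M[DC]_(1 + m, 1 + n)) :
  (forall j, M 0 j = a *+ (j == 0)) -> (forall i, M i 0 = a *+ (i == 0)) ->
  exists M', M = block_mx a%:M 0 0 M'.
Proof.
move=> M0 M1; exists (drsubmx M); rewrite -[LHS]submxK.
have l0 k : lshift k (0 : 'I_1) = 0 by apply/val_inj.
congr block_mx; apply/matrixP => i j; rewrite !mxE ?ord1 ?l0 ?M0 ?M1 //.
Qed.

(** An appreciable [mu] is invertible, so [u = mu^-1 *: v *m B] is a right
    singular vector matching [v]; in orthonormal bases starting with [v] and
    [u], the first row and column of [B] vanish off the diagonal. *)
Lemma split_singular_value_appreciable m n (B : 'M[DC]_(1 + m, 1 + n)) :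
  map_mx (@dst C) B != 0 ->
  exists P Q (mu : dual R) B',
    [/\ unitary_mx P, unitary_mx Q, 0 < dst mu &
        P *m B *m Q = block_mx (dual_complex mu)%:M 0 0 B'].
Proof.
move=> /singular_row[v [mu [v1 mu0 vB]]].
(* The inverse of mu. *)
pose nu : dual R := Dual (dst mu)^-1 (- dinf mu / (dst mu) ^+ 2).
have nu_mu : nu * mu = 1.
  apply: dualP => /=; first by rewrite mulVf // gt_eqF.
  by rewrite expr2 invfM mulrA divfK ?gt_eqF // mulrC mulNr addrN.
pose u := dual_complex nu *: (v *m B).
have cnu : dual_complex nu * dual_complex mu = 1.
  by rewrite -rmorphM nu_mu rmorph1.
have uB : u *m conjtr_mx B = dual_complex mu *: v.
  by rewrite -scalemxAl -mulmxA vB scalerA -rmorphM mulrA nu_mu mul1r.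
have u1 : u *m conjtr_mx u = 1%:M.
  rewrite {2}/u conjtr_mxZ conjtr_mxM dual_conj_complex -scalemxAr mulmxA uB.
  by rewrite -scalemxAl v1 scalerA cnu scale1r.
have vBu : v *m B = dual_complex mu *: u.
  by rewrite scalerA mulrC cnu scale1r.
have [P Pu Pv] := dual_unitary_completion v1.
have [Q Qu Qv] := dual_unitary_completion u1.
(* Both the first row and the first column reduce to this computation. *)
have row0 k (W : 'M[DC]_(1 + k)) (w : 'rV[DC]_(1 + k)) j : unitary_mx W ->
    row 0 W = w -> (dual_complex mu *: w *m conjtr_mx W) 0 j =
    dual_complex mu *+ (j == 0).
  move=> /unitary_mxV WW <-; rewrite -scalemxAl -row_mul WW !mxE eq_sym.
  by rewrite mulr_natr.
have [||M' ME] := @block_mx_of_cross m n (dual_complex mu)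
    (P *m B *m conjtr_mx Q).
- move=> j; rewrite -(row0 _ Q u j Qu Qv) -vBu -Pv -!row_mul.
  by rewrite [RHS]mxE.
- move=> i; rewrite -[LHS]dual_conjK.
  have -> : dual_conj ((P *m B *m conjtr_mx Q) i 0) =
            (Q *m conjtr_mx B *m conjtr_mx P) 0 i.
    rewrite -[Q *m _]conjtr_mxK conjtr_mxM conjtr_mxK -conjtr_mxM.
    by rewrite mulmxA [RHS]mxE [RHS]mxE.
  have -> : (Q *m conjtr_mx B *m conjtr_mx P) 0 i = dual_complex mu *+ (i == 0).
    by rewrite -(row0 _ P v i Pu Pv) -uB -Qv -!row_mul [RHS]mxE.
  by rewrite rmorphMn /= dual_conj_complex.
by exists P, (conjtr_mx Q), mu, M'; split=> //; apply: unitary_mx_conjtr.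
Qed.

Lemma split_singular_value m n (B : 'M[DC]_(1 + m, 1 + n)) : B != 0 ->
  exists P Q (mu : dual R) B',
    [/\ unitary_mx P, unitary_mx Q, 0 < mu &
        P *m B *m Q = block_mx (dual_complex mu)%:M 0 0 B'].
Proof.
move=> Bn; have [B0|B0n] := eqVneq (map_mx (@dst C) B) 0; last first.
  have [P [Q [mu [B' [Pu Qu mu0 BE]]]]] := split_singular_value_appreciable B0n.
  by exists P, Q, mu, B'; split=> //; rewrite dual_gt0E mu0.
(* Here B = B1 eps, and B1 is appreciable. *)
pose e : dual R := Dual 0 1; pose B1 := dual_mx (map_mx (@dinf C) B) 0.
have BE : B = dual_complex e *: B1.
  by rewrite dual_mxZ /= scale0r scaler0 add0r scale1r [LHS]dual_mxE B0.
have B1n : map_mx (@dst C) B1 != 0.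
  apply: contra_neq Bn => B1E; rewrite BE [B1]dual_mxE B1E.
  apply/matrixP => i j; rewrite !mxE.
  apply: dualP => /=; first by rewrite mul0r.
  by rewrite mul0r mulr0 addr0.
have [P [Q [mu [B' [Pu Qu mu0 PQ]]]]] := split_singular_value_appreciable B1n.
exists P, Q, (e * mu), (dual_complex e *: B'); split=> //.
  by rewrite dual_gt0E /= !mul0r mul1r add0r mu0 eqxx orbT.
rewrite BE -scalemxAr -scalemxAl PQ scale_block_mx !scaler0 rmorphM.
by rewrite scale_scalar_mx.
Qed.

(** The rectangular diagonal matrix with diagonal [s], extended by zeros;
    entries of [s] beyond the diagonal are ignored. *)
Definition rdiag_mx m n (s : seq (dual R)) : 'M[DC]_(m, n) :=
  \matrix_(i, j) (dual_complex (nth 0 s i) *+ (i == j :> nat)).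

Lemma rdiag_mx_nil m n : rdiag_mx m n [::] = 0.
Proof. by apply/matrixP => i j; rewrite !mxE nth_nil rmorph0 mul0rn. Qed.

Lemma rdiag_mx_cons m n mu s : rdiag_mx (1 + m) (1 + n) (mu :: s) =
  block_mx (dual_complex mu)%:M 0 0 (rdiag_mx m n s).
Proof.
apply/matrixP => i j; rewrite !mxE; case: splitP => k ik; rewrite mxE;
  case: splitP => l jl; rewrite ?mxE ik jl ?ord1 ?eqxx //=.
Qed.

Lemma mulmx_block_diag1 m n (a : 'M[DC]_1) (P : 'M_m) (B : 'M_(m, n))
    (Q : 'M_n) :
  block_mx (1%:M : 'M_1) 0 0 P *m block_mx a 0 0 B
    *m block_mx (1%:M : 'M_1) 0 0 Q
  = block_mx a 0 0 (P *m B *m Q).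
Proof.
have simp := (mul1mx, mulmx1, mul0mx, mulmx0, addr0, add0r).
by rewrite mulmx_block !simp mulmx_block !simp.
Qed.

Lemma rdiag_mx_exists m n (B : 'M[DC]_(m, n)) :
  exists P Q (s : seq (dual R)),
    [/\ unitary_mx P, unitary_mx Q, (size s <= minn m n)%N, all (> 0) s &
        P *m B *m Q = rdiag_mx m n s].
Proof.
have triv k l : exists P Q s, [/\ unitary_mx P, unitary_mx Q,
    (size s <= minn k l)%N, all (> 0) s & P *m 0 *m Q = rdiag_mx k l s].
  exists 1%:M, 1%:M, [::].
  by split; rewrite ?rdiag_mx_nil ?mulmx1 ?mulmx0 //; exact: unitary_mx1.
elim: m n B => [|m IHm] [|n] B.
- by rewrite [B]flatmx0; apply: triv.
- by rewrite [B]flatmx0; apply: triv.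
- by rewrite [B]thinmx0; apply: triv.
have [->|Bn] := eqVneq B 0; first exact: triv.
have [P [Q [mu [B' [Pu Qu mu0 BE]]]]] := @split_singular_value m n B Bn.
have [P' [Q' [s [Pu' Qu' ss s0 BE']]]] := IHm n B'.
pose P1 := block_mx (1%:M : 'M_1) 0 0 P'.
pose Q1 := block_mx (1%:M : 'M_1) 0 0 Q'.
have P1u : unitary_mx P1 := unitary_block_diag (unitary_mx1 _ _) Pu'.
have Q1u : unitary_mx Q1 := unitary_block_diag (unitary_mx1 _ _) Qu'.
exists (P1 *m P), (Q *m Q1), (mu :: s); split.
- exact: (unitary_mx_mul P1u Pu).
- exact: (unitary_mx_mul Qu Q1u).
- by rewrite /= minnSS ltnS.
- by rewrite /= mu0.
by rewrite rdiag_mx_cons -BE' -mulmx_block_diag1 -BE !mulmxA.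
Qed.

(** Permuting the diagonal of a rectangular diagonal matrix amounts to
    permuting its rows and its columns alike. *)
Lemma rdiag_mx_perm m n s s' : perm_eq s s' -> (size s <= minn m n)%N ->
  exists P Q, [/\ unitary_mx P, unitary_mx Q &
                  P *m rdiag_mx m n s *m Q = rdiag_mx m n s'].
Proof.
rewrite perm_sym => /(perm_iotaP 0)[Is pI s'E] ss.
(* Is lists, for each position of s', a position of s holding its entry; f
   extends this map by the identity, so that it acts on rows and on columns. *)
pose f k := if (k < size s)%N then nth 0%N Is k else k.
have sI : size Is = size s by rewrite (perm_size pI) size_iota.
have uI : uniq Is by rewrite (perm_uniq pI) iota_uniq.
have f_lt k : (k < size s)%N -> (f k < size s)%N.
  move=> ks; rewrite /f ks.
  have : nth 0%N Is k \in Is by rewrite mem_nth // sI.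
  by rewrite (perm_mem pI) mem_iota.
have f_id k : (size s <= k)%N -> f k = k by rewrite /f ltnNge => ->.
have f_inj : injective f.
  move=> k l; case: (ltnP k (size s)) => ks; case: (ltnP l (size s)) => ls.
  - by rewrite /f ks ls => /eqP; rewrite nth_uniq ?sI // => /eqP.
  - by rewrite [f l]f_id // => fk; move: (f_lt k ks); rewrite fk ltnNge ls.
  - by rewrite [f k]f_id // => fk; move: (f_lt l ls); rewrite -fk ltnNge ks.
  - by rewrite !f_id.
have f_bound p (i : 'I_p) : (size s <= p)%N -> (f i < p)%N.
  move=> sp; case: (ltnP i (size s)) => [/f_lt /leq_trans|/f_id->] //; exact.
have [sm sn] : (size s <= m)%N /\ (size s <= n)%N.
  by apply/andP; rewrite -leq_min.
pose g p (sp : (size s <= p)%N) (i : 'I_p) := Ordinal (f_bound p i sp).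
have g_inj p sp : injective (@g p sp).
  by move=> i j /(congr1 val) /f_inj /val_inj.
exists (perm_mx (perm (@g_inj m sm))), (perm_mx (perm (@g_inj n sn))^-1%g).
split; [exact: unitary_perm_mx|exact: unitary_perm_mx|].
rewrite -row_permE -col_permE; apply/matrixP => i j; rewrite !mxE !permE /=.
rewrite (inj_eq f_inj); congr (dual_complex _ *+ _).
rewrite s'E; case: (ltnP i (size s)) => is_.
  by rewrite /f is_ (nth_map 0%N) ?sI.
by rewrite f_id // !nth_default // size_map sI.
Qed.

(** Entrywise form of the target matrix, free of the casts in [pad_mx]. *)
Lemma pad_mx_diag m n t (mu : t.-tuple (dual R)) : (t <= minn m n)%N ->
  pad_mx m n (map_mx (@dual_complex R) (Sigma_mx mu)) = rdiag_mx m n mu.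
Proof.
rewrite leq_min => /andP[tm tn]; rewrite /pad_mx; set M := block_mx _ _ _ _.
have -> : M = rdiag_mx _ _ mu.
  apply/matrixP => i j; rewrite !mxE.
  case: splitP => k ik; rewrite mxE; case: splitP => l jl; rewrite !mxE ik jl.
  - by rewrite (tnth_nth 0) eqE /= raddfMn.
  - by rewrite ltn_eqF ?ltn_addr.
  - by rewrite gtn_eqF ?ltn_addr.
  - by rewrite nth_default ?size_tuple ?leq_addr // rmorph0 mul0rn.
clear M; move: (subnKC tm) (subnKC tn).
move: (t + (m - t))%N (t + (n - t))%N => m' n' mE nE.
by case: _ / mE; case: _ / nE; rewrite conform_mx_id.
Qed.

Lemma dual_svd_exists m n (B : 'M[DC]_(m, n)) :
  exists V U r t (mu : t.-tuple (dual R)), dual_svd B V U r mu.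
Proof.
have [P [Q [s [Pu Qu ss s0 BE]]]] := rdiag_mx_exists B.
pose s' := sort >=%O s.
have s's : perm_eq s s' by rewrite perm_sym perm_sort.
have [P' [Q' [Pu' Qu' BE']]] := rdiag_mx_perm s's ss.
have s'0 : all (> 0) s'.
  by rewrite (eq_all_r (perm_mem (permEl (perm_sort _ _)))).
have s'_sorted : sorted >=%O s' by apply: sort_sorted => p q; apply: le_total.
have s'_le i j : (i <= j < size s')%N -> nth 0 s' j <= nth 0 s' i.
  move=> /andP[ij js].
  apply: (sorted_leq_nth _ _ 0 s'_sorted) (ij) => //.
  - by move=> p q r qp rq; apply: le_trans rq qp.
  - by move=> p; apply: lexx.
  - by rewrite inE (leq_ltn_trans ij).
exists (conjtr_mx (P' *m P)), (Q *m Q'), (count (@appreciable _) s'), (size s'),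
  (in_tuple s').
have ss' : (size s' <= minn m n)%N by rewrite size_sort.
have app i : (i < size s')%N ->
    appreciable (nth 0 s' i) = (i < count (@appreciable _) s')%N.
  apply: nth_count_prefix => {}i j /[dup] /andP[ij js] /s'_le.
  have s'i : 0 < nth 0 s' i.
    by apply: (all_nthP 0 s'0); apply: leq_ltn_trans js.
  have s'j : 0 < nth 0 s' j by apply: (all_nthP 0 s'0).
  rewrite !dual_gt0_appreciable // dual_leE.
  by move=> /orP[ji j0|/andP[/eqP-> _] //]; apply: lt_trans ji.
have pos (i : 'I_(size s')) : 0 < tnth (in_tuple s') i.
  by rewrite (tnth_nth 0) /=; apply: (all_nthP 0 s'0).
split.
- by apply/unitary_mx_conjtr/unitary_mx_mul.
- exact: unitary_mx_mul.
- rewrite conjtr_mxK pad_mx_diag // -BE' -BE !mulmxA //.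
split.
- by rewrite ss' andbT count_size.
- by move=> i ir; split; rewrite ?pos // (tnth_nth 0) app.
- move=> i j /andP[ij jr]; rewrite !(tnth_nth 0) /= s'_le // ij.
  by rewrite (leq_trans jr) ?count_size.
- move=> i ir; split; rewrite ?pos // /infinitesimal (tnth_nth 0) app //.
  by rewrite -leqNgt.
- by move=> i j /andP[ri ij]; rewrite !(tnth_nth 0) /= s'_le // ij ltn_ord.
Qed.

End Existence.

(** * Uniqueness of the diagonal *)

Section Uniqueness.
Variable R : rcfType.
Local Notation C := R[i].
Local Notation DC := (dual R[i]).

Lemma conjtr_rdiag_mx m n (s : seq (dual R)) :
  conjtr_mx (rdiag_mx m n s) = rdiag_mx n m s.
Proof.
apply/matrixP => i j; rewrite !mxE rmorphMn /= dual_conj_complex eq_sym.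
by case: eqP => [->|].
Qed.

Lemma mulmx_rdiagE m n p (A : 'M[DC]_(p, m)) s i (k : 'I_m) (l : 'I_n) :
  k = l :> nat -> (A *m rdiag_mx m n s) i l = A i k * dual_complex (nth 0 s k).
Proof.
move=> kl; rewrite mxE (bigD1 k) //= big1 ?addr0 => [|k' k'k].
  by rewrite mxE kl eqxx mulr1n.
by rewrite mxE -kl -[_ == _ :> nat]/(k' == k) (negbTE k'k) mulr0n mulr0.
Qed.

Lemma rdiag_mulmxE m n p (A : 'M[DC]_(n, p)) s (k : 'I_m) (l : 'I_n) j :
  k = l :> nat -> (rdiag_mx m n s *m A) k j = dual_complex (nth 0 s k) * A l j.
Proof.
move=> kl; rewrite mxE (bigD1 l) //= big1 ?addr0 => [|l' l'l].
  by rewrite mxE kl eqxx mulr1n.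
rewrite mxE kl -[_ == _ :> nat]/(l == l') eq_sym (negbTE l'l).
by rewrite mulr0n mul0r.
Qed.

Lemma rdiag_mulmx0 m n p (A : 'M[DC]_(n, p)) s (k : 'I_m) j :
  (size s <= k)%N -> (rdiag_mx m n s *m A) k j = 0.
Proof.
move=> sk; rewrite mxE big1 // => l _.
by rewrite mxE nth_default // rmorph0 mul0rn mul0r.
Qed.

Lemma mul_dual_complex_eq0 (x : DC) (p : dual R) :
  x * dual_complex p = 0 -> p != 0 -> dst x = 0.
Proof.
case: x p => x0 x1 [a b] [] /= /eqP; rewrite mulf_eq0 => /orP[/eqP-> //|].
rewrite fmorph_eq0 => /eqP-> /eqP; rewrite rmorph0 mulr0 addr0 mulf_eq0.
by rewrite fmorph_eq0 => /orP[/eqP-> //|/eqP->]; rewrite eqxx.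
Qed.

Lemma dual_add_neq0 (p q : dual R) : 0 < p -> 0 <= q -> p + q != 0.
Proof.
move=> p0; rewrite le_eqVlt => /orP[/eqP<-|]; first by rewrite addr0 gt_eqF.
move: p0; rewrite !dual_gt0E; case: p q => a b [c d] /=.
move=> p0 q0; apply/eqP => -[]; case/orP: p0 => [a0|/andP[/eqP-> b0]].
  have c0 : 0 <= c by case/orP: q0 => [/ltW//|/andP[/eqP-> _]].
  by move/eqP; rewrite gt_eqF // ltr_pwDl.
case/orP: q0 => [c0|/andP[_ d0]] => [/eqP|_ /eqP].
  by rewrite add0r gt_eqF.
by rewrite gt_eqF // addr_gt0.
Qed.

(** [w] and [z] stand for entries of the two unitary matrices that link two
    singular value decompositions: [w + z] is killed by [p - q] and [w - z]
    by [p + q], both nonzero, so both have zero standard part. *)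
Lemma dst_intertwine_eq0 (w z : DC) (p q : dual R) :
  0 < p -> 0 <= q -> p != q ->
  w * dual_complex p = dual_complex q * z ->
  z * dual_complex p = dual_complex q * w -> dst w = 0.
Proof.
move=> p0 q0 pq wz zw.
have d1 : dst (w + z) = 0.
  apply: (@mul_dual_complex_eq0 _ (p - q)); last by rewrite subr_eq0.
  rewrite rmorphB mulrBr !mulrDl wz zw -mulrDr mulrC [z + w]addrC.
  by rewrite -mulrDl subrr.
have d2 : dst (w - z) = 0.
  apply: (@mul_dual_complex_eq0 _ (p + q)); last exact: dual_add_neq0.
  rewrite rmorphD mulrDr mulrBl wz zw -mulrBr mulrC -mulrDl.
  by rewrite [X in X * _](_ : _ = 0) ?mul0r // addrA subrK subrr.
have : dst w *+ 2 = dst (w + z) + dst (w - z).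
  by rewrite /= mulr2n addrACA subrr addr0.
by rewrite d1 d2 addr0 => /eqP; rewrite mulrn_eq0 => /eqP.
Qed.

Lemma card_nth_eq (T : eqType) m (x0 c : T) s : (size s <= m)%N -> c != x0 ->
  #|[set j : 'I_m | nth x0 s j == c]| = count_mem c s.
Proof.
move=> sm cx; rewrite cardsE -sum1_card -sum1_count (big_nth x0).
rewrite -(big_mkord (fun j => nth x0 s j == c) (fun=> 1%N)).
rewrite (big_cat_nat (n := size s)) //= -[RHS]addn0.
congr addn; rewrite big_nat_cond big1 //.
move=> j /andP[/andP[sj _]]; rewrite nth_default // eq_sym.
by rewrite (negbTE cx).
Qed.

(** If the columns [J] of a unitary matrix are supported on the rows [I], then
    counting squared moduli by columns and by rows gives [#|J| <= #|I|]. *)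
Lemma unitary_support_card m (W : 'M[C]_m) (I J : {set 'I_m}) :
  W^t* *m W = 1%:M ->
  (forall i j, j \in J -> i \notin I -> W i j = 0) -> (#|J| <= #|I|)%N.
Proof.
move=> W1 WIJ; have W2 := mulmx1C W1.
have colE j : \sum_i `|W i j| ^+ 2 = 1.
  have /matrixP/(_ j j) := W1; rewrite !mxE eqxx mulr1n => <-.
  by apply: eq_bigr => i _; rewrite !mxE normCKC.
have rowE i : \sum_j `|W i j| ^+ 2 = 1.
  have /matrixP/(_ i i) := W2; rewrite !mxE eqxx mulr1n => <-.
  by apply: eq_bigr => j _; rewrite !mxE normCK.
have cardE (A : {set 'I_m}) : #|A|%:R = \sum_(j in A) 1 :> C.
  by rewrite sumr_const.
rewrite -(ler_nat C) !cardE.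
rewrite [leLHS](eq_bigr (fun j => \sum_(i in I) `|W i j| ^+ 2)); last first.
  move=> j jJ; rewrite -(colE j) (bigID (mem I)) /=.
  rewrite [X in _ + X]big1 ?addr0 // => i iI.
  by rewrite WIJ // normr0 expr0n.
rewrite exchange_big /=; apply: ler_sum => i _.
rewrite -(rowE i) [leRHS](bigID (mem J)) /= lerDl.
by apply: sumr_ge0 => j _; rewrite exprn_ge0.
Qed.

(** Unitarily equivalent diagonal matrices: the multiplicity of [c > 0] on the
    first diagonal is at most its multiplicity on the second. *)
Lemma rdiag_mx_count_le m n (s s' : seq (dual R)) (W : 'M[DC]_m)
    (Z : 'M[DC]_n) c :
  unitary_mx W -> unitary_mx Z ->
  W *m rdiag_mx m n s = rdiag_mx m n s' *m Z ->
  (size s <= minn m n)%N -> (size s' <= minn m n)%N ->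
  all (> 0) s' -> 0 < c -> (count_mem c s <= count_mem c s')%N.
Proof.
move=> Wu Zu WZ; rewrite !leq_min => /andP[sm sn] /andP[s'm s'n] s'0 c0.
have ZW : Z *m rdiag_mx n m s = rdiag_mx n m s' *m W.
  have := congr1 (@conjtr_mx _ _ _) WZ.
  rewrite !conjtr_mxM !conjtr_rdiag_mx => SW.
  rewrite -[LHS]mulmx1 -Wu mulmxA -(mulmxA Z) SW !mulmxA.
  by rewrite (unitary_mxV Zu) mul1mx.
have cn0 : c != 0 by rewrite gt_eqF.
rewrite -(card_nth_eq sm cn0) -(card_nth_eq s'm cn0).
apply: (@unitary_support_card _ (map_mx (@dst C) W)).
  have := Wu; rewrite /unitary_mx [in LHS](dual_mxE W) conjtr_dual_mx dual_mxM.
  by rewrite dual_mx1 => /dual_mx_inj[].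
move=> i j; rewrite !inE mxE => /eqP sj s'i.
have js : (j < size s)%N.
  by rewrite ltnNge; apply: contra cn0 => js; rewrite -sj nth_default.
pose jn := Ordinal (leq_trans js sn).
have wE : (W *m rdiag_mx m n s) i jn = W i j * dual_complex c.
  by rewrite (@mulmx_rdiagE _ _ _ _ _ _ j) ?sj.
have [is'|is'] := ltnP i (size s'); last first.
  apply: (@mul_dual_complex_eq0 _ c) => //.
  by rewrite -wE WZ rdiag_mulmx0.
pose in_ := Ordinal (leq_trans is' s'n).
apply: (@dst_intertwine_eq0 _ (Z in_ jn) c (nth 0 s' i)) => //.
- by apply/ltW/(all_nthP 0 s'0).
- by rewrite eq_sym.
- by rewrite -wE WZ (@rdiag_mulmxE _ _ _ _ _ _ in_).
- have := congr1 (fun M : 'M_(_, _) => M in_ j) ZW.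
  rewrite (@mulmx_rdiagE _ _ _ _ _ _ jn) //.
  by rewrite (@rdiag_mulmxE _ _ _ _ _ _ i) //= sj.
Qed.

Lemma dual_svd_all_gt0 m n (B : 'M[DC]_(m, n)) V U r t
    (mu : t.-tuple (dual R)) :
  dual_svd B V U r mu -> all (> 0) mu.
Proof.
case=> _ _ _ [_ app _ inf _]; apply/allP => x /tnthP[i ->].
by have [/app[]|/inf[]] := ltnP i r.
Qed.

Lemma dual_svd_sorted m n (B : 'M[DC]_(m, n)) V U r t (mu : t.-tuple (dual R)) :
  dual_svd B V U r mu -> sorted >=%O mu.
Proof.
case=> _ _ _ [_ app app_le inf inf_le]; apply/(sortedP 0) => i.
rewrite size_tuple => i1t; have it : (i < t)%N := ltnW i1t.
have [-> ->] : nth 0 mu i = tnth mu (Ordinal it) /\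
               nth 0 mu i.+1 = tnth mu (Ordinal i1t) by rewrite !(tnth_nth 0).
have [i1r|ri1] := ltnP i.+1 r; first by apply: app_le; rewrite /= leqnSn.
have [ir|ri] := ltnP i r; last by apply: inf_le; rewrite /= ri leqnSn.
have [a0 aa] := app (Ordinal it) ir.
have [_ /negPn/eqP bb] := inf (Ordinal i1t) ri1.
by rewrite /= dual_leE bb -(dual_gt0_appreciable a0) aa.
Qed.

Lemma dual_svd_count_le m n (B : 'M[DC]_(m, n)) V V' U U' r r' t t'
    (mu : t.-tuple (dual R)) (mu' : t'.-tuple (dual R)) c :
  dual_svd B V U r mu -> dual_svd B V' U' r' mu' -> 0 < c ->
  (count_mem c mu <= count_mem c mu')%N.
Proof.
move=> svd svd'; have mu'0 := dual_svd_all_gt0 svd'.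
case: svd svd' => Vu Uu BE [/andP[_ tmn] _ _ _ _].
case=> Vu' Uu' BE' [/andP[_ t'mn] _ _ _ _].
rewrite pad_mx_diag // in BE; rewrite pad_mx_diag // in BE'.
apply: (@rdiag_mx_count_le m n _ _ (conjtr_mx V' *m V) (conjtr_mx U' *m U));
  rewrite ?size_tuple //.
- by apply: unitary_mx_mul => //; apply: unitary_mx_conjtr.
- by apply: unitary_mx_mul => //; apply: unitary_mx_conjtr.
rewrite -BE -BE' !mulmxA -(mulmxA _ V) (unitary_mxV Vu) mulmx1.
by rewrite -(mulmxA _ U') (unitary_mxV Uu') mulmx1.
Qed.

Lemma dual_svd_rank_le m n (B : 'M[DC]_(m, n)) V V' U U' r r' t t'
    (mu : t.-tuple (dual R)) (mu' : t'.-tuple (dual R)) :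
  dual_svd B V U r mu -> dual_svd B V' U' r' mu' -> tval mu = tval mu' ->
  (r <= r')%N.
Proof.
case=> _ _ _ [/andP[rt _] app _ _ _] [_ _ _ [_ _ _ inf' _]] mumu'.
rewrite leqNgt; apply/negP => r'r.
have r't : (r' < t)%N := leq_trans r'r rt.
have r't' : (r' < t')%N by rewrite -(size_tuple mu') -mumu' size_tuple.
have [_ a] := app (Ordinal r't) r'r.
have [_] := inf' (Ordinal r't') (leqnn _); move: a.
by rewrite /infinitesimal !(tnth_nth 0) mumu' => ->.
Qed.

Lemma dual_svd_unique m n (B : 'M[DC]_(m, n)) V V' U U' r r' t t'
    (mu : t.-tuple (dual R)) (mu' : t'.-tuple (dual R)) :
  dual_svd B V U r mu -> dual_svd B V' U' r' mu' ->
  r = r' /\ t = t' /\ tval mu = tval mu'.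
Proof.
move=> svd svd'; have mumu' : tval mu = tval mu'.
  apply: (@sorted_eq _ >=%O);
    rewrite ?(dual_svd_sorted svd) ?(dual_svd_sorted svd') //.
  - by move=> p q x qp xq; apply: le_trans xq qp.
  - by move=> p q; rewrite andbC; apply: le_anti.
  apply/allP => c; rewrite mem_cat => c_in; apply/eqP/anti_leq.
  have c0 : 0 < c.
    have /allP mu0 := dual_svd_all_gt0 svd.
    have /allP mu'0 := dual_svd_all_gt0 svd'.
    by case/orP: c_in; [apply: mu0|apply: mu'0].
  by rewrite (dual_svd_count_le svd svd' c0) (dual_svd_count_le svd' svd c0).
split; last by split; rewrite // -(size_tuple mu) mumu' size_tuple.
apply/anti_leq; rewrite (dual_svd_rank_le svd svd') //.
by rewrite (dual_svd_rank_le svd' svd).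
Qed.

End Uniqueness.

Theorem theorem5p2 (R : realType) (m n : nat) (B : 'M[dual R[i]]_(m, n)) :
  (exists (V : 'M[dual R[i]]_m) (U : 'M[dual R[i]]_n)
          (r t : nat) (mu : t.-tuple (dual R)),
     dual_svd B V U r mu) /\
  (forall (V V' : 'M[dual R[i]]_m) (U U' : 'M[dual R[i]]_n)
          (r r' t t' : nat)
          (mu : t.-tuple (dual R)) (mu' : t'.-tuple (dual R)),
     dual_svd B V U r mu -> dual_svd B V' U' r' mu' ->
     r = r' /\ t = t' /\ tval mu = tval mu').
Proof.
split; first exact: dual_svd_exists.
by move=> V V' U U' r r' t t' mu mu'; apply: dual_svd_unique.
Qed.
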